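(* There exist absolute constants $C>0$ and $K>0$ such that the following holds for every absolutely continuous probability measure on $\mathbb{R}$, with (continuous) cumulative distribution function $F$, every integer $n\ge 1$ and every real $m$ with $0\le m\le 0.001\,n$. Let $x_1,\dots,x_n$ be independent real-valued random variables, each distributed according to this probability measure, and let $X=\{x_1,\dots,x_n\}$. Then, with probability at least $1-K n^{-C}$, there exists a subset $Y\subset X$ with $$\# Y\ge \# X-m$$ such that $$\sup_{x\in\mathbb{R}}\left|\frac{\#(Y\cap(-\infty,x])}{\# Y}-F(x)\right|\le 100\,\frac{\log n}{m}$$ (for $m=0$ the right-hand side is interpreted as $+\infty$).
   Context: $\#$ denotes cardinality and $\log$ is the natural logarithm. Absolutely continuous means absolutely continuous with respect to Lebesgue measure, and $F(x)$ is the probability that a sample is at most $x$. The points $x_1,\dots,x_n$ are almost surely distinct, so $\#X=n$ almost surely. The subset $Y$ may depend on the realization of $X$. Convention: an event depending on $n$ holds ''with high likelihood'' (or ''with high probability'') if the probability of its complement is of the order $n^{-C}$ for some constant $C>0$; this is what is written out explicitly in the claim. *)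

(* Defs.v *)
From HB Require Import structures.
From mathcomp Require Import all_boot all_order all_algebra finmap.
From mathcomp Require Import all_classical all_reals all_analysis.
Set Implicit Arguments.
Unset Strict Implicit.
Unset Printing Implicit Defensive.
Import Order.TTheory GRing.Theory Num.Theory.
Import numFieldNormedType.Exports.
Local Open Scope classical_set_scope.
Local Open Scope ring_scope.

(* Mutual independence; quantifying over J gives the product rule for every
   finite subfamily. *)
Definition independent_RVs (R : realType) d (T : measurableType d)
    (P : probability T R) (I : finType) (X : I -> {RV P >-> R}) : Prop :=
  forall (J : {set I}) (A : I -> set R), (forall i, measurable (A i)) ->
    P (\bigcap_(i in [set` J]) (X i @^-1` A i)) =
    (\prod_(i in J) P (X i @^-1` A i))%E.

Definition same_distribution (R : realType) d (T : measurableType d)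
    (P : probability T R) (X : {RV P >-> R}) (mu : probability R R) : Prop :=
  forall A : set R, measurable A -> distribution P X A = mu A.

Definition cdf_of (R : realType) (mu : probability R R) (x : R) : R :=
  fine (mu [set` `]-oo, x]]).

Definition sample_set (R : realType) (n : nat) (x : 'I_n -> R) : {fset R} :=
  [fset x i | i in 'I_n]%fset.

(* #(Y `&` ]-oo, x]) / #Y; the value is 0 when Y is empty, which happens only
   on a null event in the theorem since there m < n. *)
Definition empirical_cdf (R : realType) (Y : {fset R}) (x : R) : R :=
  #|` [fset y in Y | y <= x]%fset |%:R / #|` Y|%:R.

(* An extended real, so that the supremum is the true one. *)
Definition discrepancy (R : realType) (Y : {fset R}) (F : R -> R) : \bar R :=
  ereal_sup [set `|empirical_cdf Y x - F x|%:E | x in [set: R]].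

(* x / m for m > 0, with x / 0 read as +oo (division by 0 yields 0 in R). *)
Definition div_or_pinfty (R : realType) (x m : R) : \bar R :=
  if m == 0 then +oo%E else (x / m)%:E.

(* Main.v *)
Require Import Defs.
From HB Require Import structures.
From mathcomp Require Import all_boot all_order all_algebra finmap.
From mathcomp Require Import all_classical all_reals all_analysis.
From mathcomp Require Import measurable_realfun.
From mathcomp Require Import ring lra.
Import Order.TTheory GRing.Theory Num.Theory.
Import numFieldNormedType.Exports.
Local Open Scope classical_set_scope.
Local Open Scope ring_scope.
Set Implicit Arguments.
Unset Strict Implicit.

(** Write q = n - m and let N(s, t) be the number of sample points whose
    F-value lies in ]s, t[.  Deleting points can only repair an excess, so what
    has to be excluded is a band ]s, t[ holding much fewer than its share
    q (t - s) of the q points that survive.  This is a one-sided event, and the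
    m points that may be deleted give a margin that grows with the band: on
    average a band holds n (t - s) points, which is m (t - s) more than its
    share.  Chernoff's bound at the parameter m / n makes the probability that
    N(s, t) <= q (t - s) - D at most exp (- m D / n), uniformly in s and t
    ([chernoff_lower], [sparse_band_prob]).  With D = 4 n log n / m this is n^-4, so a union bound
    over the bands with endpoints in the grid Z / n costs O(n^-2), and every
    band ]s, t[ then satisfies N(s, t) >= q (t - s) - (D + 2).

    Given these lower bounds, one sweep through the sorted sample finds Y
    ([greedy_thinning]): a point is deleted exactly when the points kept so far
    exceed q F and the number of deletions stays at most m.  This rule keeps Y
    from being too dense on the left of x; since the last deletion before x
    occurred at an excess and everything was kept since, the lower bounds on N
    keep Y from being too sparse.  If the deletions run out, everything further
    right is kept and the lower bound on the sample right of x gives the upper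
    bound left of x.  The resulting error is O(D) points out of about n, that is
    O(log n / m) ([thinning_discrepancy], [dense_grid_thinning]).

    Two facts complete the argument.  The sample points are almost surely
    distinct ([sample_tie_null]), so that counting values agrees with counting
    indices.  The event is measurable ([measurable_exists_subsample]): Y ranges
    over the images of the finitely many sets of indices, and by
    right-continuity the supremum may be taken over the rationals. *)

(** * Thinning a sample deterministically *)

(** The points of s are visited in increasing order, and a point y is deleted
    exactly when more than q F(y) points were kept before it and the number of
    deletions stays at most m.  The last two clauses say what each rule gives
    at a threshold z.  Either no point up to z was deleted, or at the last
    deletion y the kept points exceeded q F(y) and all points of ]y, z] were
    kept.  Either the last kept point up to z was kept for lack of excess, or
    the deletions were exhausted (one more would exceed m) and all points
    beyond z were kept. *)
Lemma greedy_thinning (R : realFieldType) (F : R -> R) (q m : R) (s : seq R) :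
  {homo F : x y / x <= y} -> (forall x, 0 <= F x) -> 0 <= q -> 0 <= m ->
  sorted <=%R s ->
  exists t : seq R, [/\ subseq t s,
    (size s)%:R - m <= (size t)%:R,
    forall z, count (<= z) t = count (<= z) s \/
      exists2 y, y <= z &
        q * F y + (count (fun u => y < u <= z) s)%:R <= (count (<= z) t)%:R &
    forall z, (count (<= z) t)%:R <= q * F z + 1 \/
      (size t)%:R < (size s)%:R - m + 1 /\
        count (> z) t = count (> z) s].
Proof.
move=> Fmono F0 q0 m0; rewrite le_sorted_pairwise.
elim/last_ind: s => [|s y IH].
  move=> _; exists [::]; split => //=; first by rewrite sub0r oppr_le0.
    by move=> z; left.
  by move=> z; left; rewrite addr_ge0// mulr_ge0.
rewrite pairwise_rcons => /andP[/allP sy /IH{IH}[t [ts tm tL tU]]].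
have ty u : u \in t -> u <= y by move=> /(mem_subseq ts)/sy.
have crc (p : pred R) r : count p (rcons r y) = (count p r + p y)%N.
  by rewrite -cats1 count_cat /= addn0.
have full r z : (forall u, u \in r -> u <= y) -> y <= z ->
    count (<= z) r = size r.
  move=> ry yz; apply/eqP; rewrite -all_count; apply/allP => u /ry uy /=.
  exact: le_trans yz.
have none r a z : (forall u, u \in r -> u <= y) -> y <= a ->
    count (fun u => a < u <= z) r = 0%N.
  move=> ry ya; apply/eqP; rewrite -leqn0 leqNgt -has_count; apply/hasPn.
  by move=> u /ry uy /=; rewrite ltNge (le_trans uy ya).
have noneu r z : (forall u, u \in r -> u <= y) -> y <= z ->
    count (> z) r = 0%N.
  move=> ry ya; apply/eqP; rewrite -leqn0 leqNgt -has_count; apply/hasPn.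
  by move=> u /ry uy /=; rewrite ltNge (le_trans uy ya).
(* The new maximum y is deleted in the first case and kept in the second. *)
have [/andP[del over]|keep] := boolP
    (((size s).+1%:R - m <= (size t)%:R :> R) && (q * F y < (size t)%:R)).
  exists t; split => //.
  - exact: subseq_trans ts (subseq_rcons _ _).
  - by rewrite size_rcons.
  - move=> z; rewrite !crc /=; have [yz|zy] := leP y z.
      right; exists y => //; rewrite crc /= none// ltxx/= addr0.
      by rewrite full// ltW.
    rewrite addn0; case: (tL z) => [->|[v vz vt]]; [by left|right].
    by exists v => //; rewrite crc /= (leNgt y z) zy andbF addn0.
  - move=> z; case: (tU z) => [->|[dt _]]; [by left|exfalso].
    by move: del dt; rewrite -natr1; lra.
exists (rcons t y); split => //.
- rewrite -!cats1; exact: cat_subseq.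
- by rewrite !size_rcons -!natr1; lra.
- move=> z; rewrite !crc /=; case: (tL z) => [->|[v vz vt]]; [by left|right].
  exists v => //; rewrite crc /= !natrD; have [yz|zy] := leP y z.
    by rewrite andbT; move: vt; case: (v < y) => /=; lra.
  by rewrite andbF; lra.
- move=> z; rewrite !crc !size_rcons /=.
  have [yz|zy] := leP y z; last first.
    rewrite addn0; case: (tU z) => [|[tm' ->]]; first by left.
    by right; split=> //; rewrite -!natr1; lra.
  rewrite full// noneu// noneu//.
  move: keep; rewrite negb_and -!ltNge; case/orP => h.
    by right; rewrite -!natr1 in h *; split=> //; lra.
  left; rewrite natrD lerD2r.
  by rewrite -leNgt in h; rewrite (le_trans h)// ler_wpM2l// Fmono.
Qed.

Lemma card_fset_filter (K : choiceType) (Y : {fset K}) (p : pred K) :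
  #|` [fset y in Y | p y]%fset| = count p Y.
Proof.
have /perm_size -> : perm_eq [fset y in Y | p y]%fset [seq y <- Y | p y].
  apply: uniq_perm; rewrite ?fset_uniq ?filter_uniq ?fset_uniq// => y.
  by rewrite mem_filter !inE/= andbC.
by rewrite size_filter.
Qed.

(** The kept count up to z is q F(z) up to D + 1, and the total number of kept
    points lies between q and q + 1; passing from q to this total in the
    normalisation costs one more point. *)
Lemma thinning_discrepancy (R : realType) (F : R -> R) (m D : R)
    (X : {fset R}) :
  {homo F : x y / x <= y} -> (forall x, 0 <= F x <= 1) ->
  0 <= m < #|` X|%:R -> 0 <= D ->
  (forall s t, 0 <= s -> s <= t -> t <= 1 ->
    (#|` X|%:R - m) * (t - s) - D <= (count (fun x => s < F x < t) X)%:R) ->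
  exists Y : {fset R}, [/\ (Y `<=` X)%fset,
    #|` X|%:R - m <= #|` Y|%:R &
    forall z, `|empirical_cdf Y z - F z| <= (D + 2) / (#|` X|%:R - m)].
Proof.
move=> Fmono F01 /andP[m0 mX] D0 dense.
have F0 x : 0 <= F x by have /andP[] := F01 x.
have F1 x : F x <= 1 by have /andP[] := F01 x.
have FltP x y : F x < F y -> x < y.
  by move=> xy; rewrite ltNge; apply/negP => /Fmono; rewrite leNgt xy.
set q := #|` X|%:R - m in dense *.
have q0 : 0 < q by rewrite subr_gt0.
pose s := sort <=%R (X : seq R).
have sX : perm_eq s X by rewrite perm_sort.
have cs p : count p s = count p X by apply/permP.
have sz : size s = #|` X| by rewrite size_sort.
have [t [ts tm tL tU]] := greedy_thinning Fmono F0 (ltW q0) m0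
  (sort_sorted (@le_total _ _) _ : sorted <=%R s).
rewrite sz -/q in tm tU.
have ut : uniq t by apply: subseq_uniq ts _; rewrite sort_uniq fset_uniq.
pose Y := [fset x in t]%fset.
have Yt : perm_eq Y t.
  apply: uniq_perm; rewrite ?fset_uniq// => x; exact: in_fset.
have szY : #|` Y| = size t by rewrite -(perm_size Yt).
exists Y; split.
- apply/fsubsetP => x; rewrite in_fset/= => /(mem_subseq ts).
  by rewrite mem_sort.
- by rewrite szY.
move=> z; rewrite /empirical_cdf szY.
rewrite card_fset_filter (permP Yt).
have sub_count p1 p2 : subpred p1 p2 -> (count p1 X)%:R <= (count p2 s)%:R :> R.
  by move=> p12; rewrite ler_nat cs; apply: sub_count.
(* Both alternatives of the greedy sweep bound the total from above, at a
   threshold w beyond all points. *)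
have tq : (size t)%:R <= q + 1.
  have [w /eqP wP] : exists w, count (<= w) t == size t.
    exists (\big[Num.max/0]_(u <- t) u); rewrite -all_count.
    apply/allP => u ut'.
    exact: le_bigmax_seq.
  have := tU w; rewrite wP => -[h|[/ltW//]].
  by apply: (le_trans h); rewrite lerD2r ler_piMr// ltW.
set K := (count (<= z) t)%:R : R.
have lowK : q * F z - D <= K.
  have := tL z; rewrite -/K; case=> [E|[y yz h]].
    have := dense 0 (F z) (lexx _) (F0 z) (F1 z); rewrite subr0 => h.
    rewrite /K E; apply: (le_trans h); apply: sub_count => x /andP[_ /FltP].
    exact: ltW.
  have := dense (F y) (F z) (F0 y) (Fmono _ _ yz) (F1 z).
  have : (count (fun x => F y < F x < F z) X)%:R <=
         (count (fun x => y < x <= z) s)%:R :> R.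
    by apply: sub_count => x /andP[/FltP -> /FltP/ltW ->].
  by move: h; rewrite -/K; nra.
have upK : K <= q * F z + D + 1.
  have := tU z; rewrite -/K; case=> [h|[tq' E]]; first by lra.
  have KE : K = (size t)%:R - (count (> z) s)%:R.
    rewrite -E -(count_predC (<= z) t) natrD /K -addrA.
    rewrite (@eq_count _ (predC (<= z)) (> z)) ?subrr ?addr0// => x /=.
    by rewrite ltNge.
  have := dense (F z) 1 (F0 z) (F1 z) (lexx _).
  have : (count (fun x => F z < F x < 1) X)%:R <= (count (> z) s)%:R :> R.
    by apply: sub_count => x /andP[/FltP].
  by rewrite KE; nra.
have t0 : 0 < (size t)%:R :> R by apply: lt_le_trans tm.
rewrite -[F z](mulfK (lt0r_neq0 t0)) -mulrBl normrM normfV (gtr0_norm t0).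
apply: ler_pM => //; last by rewrite lef_pV2 ?posrE.
have := F0 z; have := F1 z.
by rewrite ler_norml => ? ?; apply/andP; split; nra.
Qed.

(** * The distribution function of a law without atoms *)

Section cdf.
Variables (R : realType) (mu : probability R R).
(* [cdf] is attached to a random variable; [cdf_of mu] is the real-valued
   version for the identity under mu. *)
Let idR : R -> R := idfun.
HB.instance Definition _ :=
  @isMeasurableFun.Build _ _ _ _ idR (@measurable_id _ _ setT).
Let cdfE : cdf_of mu = fine \o cdf (idR : {RV mu >-> R}).
Proof. by []. Qed.

Lemma cdf_of_le x y : x <= y -> cdf_of mu x <= cdf_of mu y.
Proof.
by move=> xy; rewrite cdfE/= fine_le ?fin_num_measure// cdf_nondecreasing.
Qed.

Lemma cdf_of01 x : 0 <= cdf_of mu x <= 1.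
Proof.
rewrite fine_ge0//= -lee_fin fineK ?fin_num_measure//.
exact: probability_le1.
Qed.

Lemma cdf_of_right_continuous x : cdf_of mu y @[y --> x^'+] --> cdf_of mu x.
Proof.
apply: fine_cvg; rewrite fineK ?fin_num_measure//.
exact: (@cdf_right_continuous _ _ _ _ (idR : {RV mu >-> R})).
Qed.

Lemma measurable_cdf_of : measurable_fun setT (cdf_of mu).
Proof.
by apply: nondecreasing_measurable => // x y; exact: cdf_of_le.
Qed.

Lemma cdf_of_itv x y : x <= y ->
  mu `]x, y]%classic = (cdf_of mu y - cdf_of mu x)%:E.
Proof.
move=> xy; have -> : `]x, y]%classic = `]-oo, y]%classic `\` `]-oo, x]%classic.
  by rewrite -[RHS]setCK setCD setCitvl setUC -[LHS]setCK setCitv.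
rewrite measureD ?setIidr//.
- by rewrite EFinB !fineK ?fin_num_measure.
- exact: subset_itvl.
- by rewrite -ge0_fin_numE// fin_num_measure.
Qed.

Let cvg_cdf_ofNy : cdf_of mu @ -oo --> (0 : R).
Proof. exact/fine_cvg/(@cvg_cdfNy0 _ _ _ _ (idR : {RV mu >-> R})). Qed.

Let cvg_cdf_ofy : cdf_of mu @ +oo --> (1 : R).
Proof. exact/fine_cvg/(@cvg_cdfy1 _ _ _ _ (idR : {RV mu >-> R})). Qed.

(** The quantile s is the infimum of the z with a <= F(z).  Right-continuity
    gives a <= F(s); as s carries no mass, F(s) is the mass of ]-oo, s[, a
    limit of values F(s - 1/k) < a. *)
Lemma cdf_of_quantile a : mu `<< (@lebesgue_measure R) -> 0 < a < 1 ->
  exists s, cdf_of mu s = a.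
Proof.
move=> /null_content_dominatesP ac /andP[a0 a1].
have [z0 z0a] : exists z, cdf_of mu z < a.
  have /cvgr_lt/(_ _ a0)[M [_ h]] := cvg_cdf_ofNy.
  by exists (M - 1); apply: h; rewrite ltrBlDr ltrDl.
have [z1 z1a] : exists z, a < cdf_of mu z.
  have /cvgr_gt/(_ _ a1)[M [_ h]] := cvg_cdf_ofy.
  by exists (M + 1); apply: h; rewrite ltrDl.
pose S := [set z | a <= cdf_of mu z].
have Slb : lbound S z0.
  move=> z Sz; rewrite leNgt; apply/negP => zz0.
  by have := cdf_of_le (ltW zz0); rewrite leNgt (lt_le_trans z0a Sz).
have infS : has_inf S by split; [exists z1; exact: ltW | exists z0].
pose s := inf S; exists s.
have below z : z < s -> cdf_of mu z < a.
  by move=> zs; rewrite ltNge; apply/negP => /(ge_inf infS.2); rewrite leNgt zs.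
apply/le_anti/andP; split.
  rewrite -lee_fin fineK ?fin_num_measure//.
  rewrite -(@setUitv1 _ _ _ s true)// measureU//; last first.
    apply/seteqP; split => // z [/=]; rewrite in_itv/= => + zs.
    by rewrite zs ltxx.
  have mus : mu [set s] = 0%E by apply: ac => //; exact: lebesgue_measure_set1.
  rewrite [X in (_ + X)%R]mus adde0.
  pose G k := `]-oo, s - k.+1%:R^-1]%classic.
  have GE : `]-oo, s[%classic = \bigcup_k G k.
    apply/seteqP; split => z /=; rewrite in_itv/=.
      move=> /ltr_add_invr[k zk]; exists k => //; rewrite /G/= in_itv/=.
      by rewrite lerBrDr ltW.
    move=> [k _]; rewrite /G/= in_itv/= => /le_lt_trans; apply.
    by rewrite ltrBlDr ltrDl.
  have cvgG : mu (G k) @[k --> \oo] --> mu (\bigcup_k G k).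
    apply: nondecreasing_cvg_mu.
    - by move=> k; exact: measurable_itv.
    - by rewrite -GE; exact: measurable_itv.
    move=> j k jk; apply/subsetPset; apply: subset_itvl.
    by rewrite bnd_simp lerB// lef_pV2 ?posrE// ler_nat.
  have : (mu (\bigcup_k G k) <= a%:E)%E; last by rewrite GE.
  rewrite -(cvg_lim _ cvgG)//; apply: lime_le.
    by apply/cvg_ex; exists (mu (\bigcup_k G k)).
  apply: nearW => k; have /ltW : cdf_of mu (s - k.+1%:R^-1) < a.
    by apply: below; rewrite ltrBlDr ltrDl.
  by rewrite -lee_fin fineK ?fin_num_measure.
rewrite leNgt; apply/negP => Fsa.
have /cvgr_lt/(_ _ Fsa)[e /= e0 h] := @cdf_of_right_continuous s.
have [z Sz] := @inf_adherent _ S e e0 infS; rewrite -/s => zse.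
have sz : s <= z by apply: ge_inf => //; exact: infS.2.
move: Sz; rewrite /S/= leNgt => /negP; apply.
move: sz; rewrite le_eqVlt => /predU1P[<-//|sz].
apply: h => //=; rewrite distrC ger0_norm ?subr_ge0 ?ltW//.
by rewrite ltrBlDl.
Qed.

Lemma measurable_cdf_band (i : interval R) :
  measurable [set z | cdf_of mu z \in i].
Proof.
rewrite -[X in measurable X]setTI.
apply: (measurable_cdf_of measurableT (Y := [set` i])).
exact: measurable_itv.
Qed.

(** F maps mu to the uniform law on [0, 1].  This lemma and the next bound the
    mass of a band of F-values from both sides.  The band contains ]s, t] for
    quantiles s, t of levels slightly inside it; the levels stay inside ]0, 1[,
    where quantiles exist. *)
Lemma cdf_band_ge a b : mu `<< (@lebesgue_measure R) ->
  0 <= a -> b <= 1 -> ((b - a)%:E <= mu [set z | cdf_of mu z \in `]a, b[])%E.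
Proof.
move=> ac a0 b1; have mB := measurable_cdf_band `]a, b[.
rewrite -[X in (_ <= X)%E]fineK ?fin_num_measure// lee_fin.
apply/ler_addgt0Pl => e e0.
have p0 : 0 <= fine (mu [set z | cdf_of mu z \in `]a, b[]) by exact: fine_ge0.
have [be|eb] := lerP (b - a) e; first by rewrite (le_trans be)// lerDl.
have [s sE] : exists s, cdf_of mu s = a + e / 2.
  by apply: cdf_of_quantile => //; apply/andP; split; lra.
have [t tE] : exists s, cdf_of mu s = b - e / 2.
  by apply: cdf_of_quantile => //; apply/andP; split; lra.
have st : s <= t.
  by rewrite leNgt; apply/negP => /ltW/cdf_of_le; rewrite sE tE; lra.
have : (mu `]s, t]%classic <= mu [set z | cdf_of mu z \in `]a, b[])%E.
  apply: le_measure; rewrite ?inE//.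
  move=> z /=; rewrite !in_itv/= => /andP[/ltW/cdf_of_le + /cdf_of_le].
  by rewrite sE tE => ? ?; apply/andP; split; lra.
rewrite cdf_of_itv// -[X in (_ <= X)%E]fineK ?fin_num_measure// lee_fin sE tE.
lra.
Qed.

(** The bands below a and above b already carry mass a and 1 - b. *)
Lemma cdf_band_le a b : mu `<< (@lebesgue_measure R) ->
  0 <= a -> a <= b -> b <= 1 ->
  (mu [set z | cdf_of mu z \in `[a, b]] <= (b - a)%:E)%E.
Proof.
move=> ac a0 ab b1.
have mB := measurable_cdf_band.
have := cdf_band_ge ac (lexx 0) (le_trans ab b1).
have := cdf_band_ge ac (le_trans a0 ab) (lexx 1).
set L := [set z | cdf_of mu z \in `]0, a[] => /=.
set U := [set z | cdf_of mu z \in `]b, 1[] => /=.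
set M := [set z | cdf_of mu z \in `[a, b]] => /=.
move=> hU hL.
have mL : measurable L by exact: mB.
have mM : measurable M by exact: mB.
have mU : measurable U by exact: mB.
have : (mu (L `|` M `|` U) <= 1)%E.
  by apply: probability_le1; apply: measurableU => //; exact: measurableU.
have -> : mu (L `|` M `|` U) = (mu L + mu M + mu U)%E.
  rewrite !measureU//; try exact: measurableU.
    by apply/seteqP; split => // z; rewrite /L /M/= !in_itv/=; lra.
  by apply/seteqP; split => // z; rewrite /L /M /U/= !in_itv/=; lra.
have fin A : measurable A -> exists r, mu A = r%:E.
  by move=> mA; exists (fine (mu A)); rewrite fineK// fin_num_measure.
have [l lE] := fin _ mL; have [k kE] := fin _ mM; have [u uE] := fin _ mU.
by move: hU hL; rewrite lE kE uE -!EFinD !lee_fin; lra.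
Qed.
End cdf.

(** * Lower tail of the number of sample points in a set *)

Lemma union_bound d (T : measurableType d) (R : realType)
    (P : {measure set T -> \bar R}) (I : finType) (A : set T) (B : I -> set T) :
  measurable A -> (forall i, measurable (B i)) ->
  (forall w, A w -> exists i, B i w) -> (P A <= \sum_i P (B i))%E.
Proof.
move=> mA mB AB.
rewrite fsbig_seq ?index_enum_uniq//.
apply: content_sub_fsum => //.
by move=> w /AB[i Bi]; exists i => //=; rewrite mem_index_enum.
Qed.

(** A random set of indices takes finitely many values, so every property of it
    defines an event as soon as each index is a member on an event. *)
Lemma measurable_finset_pattern d (T : measurableType d) (I : finType)
    (f : T -> {set I}) (Q : {set I} -> Prop) :
  (forall i, measurable [set w | i \in f w]) -> measurable [set w | Q (f w)].
Proof.
move=> mf.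
have -> : [set w | Q (f w)] = \bigcup_(A in [set A | Q A]) [set w | f w = A].
  by apply/seteqP; split=> [w Qw|w [A QA /= ->//]]; exists (f w).
apply: fin_bigcup_measurable => [|A _]; first exact: finite_finset.
have -> : [set w | f w = A] = \bigcap_(i in [set: I])
    (if i \in A then [set w | i \in f w] else ~` [set w | i \in f w]).
  apply/seteqP; split=> [w /= <- i _|w h /=].
    by case: ifPn => // /negP.
  apply/setP => i; have := h i Logic.I; case: (i \in A) => //= /negP.
  by move=> /negbTE.
apply: fin_bigcap_measurable => [|i _]; first exact: finite_finset.
by case: ifP => _; [|apply: measurableC]; exact: mf.
Qed.

Lemma measurable_finset_pattern2 d (T : measurableType d) (I : finType)
    (f g : T -> {set I}) (Q : {set I} -> {set I} -> Prop) :
  (forall i, measurable [set w | i \in f w]) ->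
  (forall i, measurable [set w | i \in g w]) ->
  measurable [set w | Q (f w) (g w)].
Proof.
move=> mf mg.
have -> : [set w | Q (f w) (g w)] =
    \bigcup_(A in [set: {set I}]) ([set w | f w = A] `&` [set w | Q A (g w)]).
  by apply/seteqP; split=> [w Qw|w [A _ [/= -> //]]]; exists (f w).
apply: fin_bigcup_measurable => [|A _]; first exact: finite_finset.
apply: measurableI; last exact: measurable_finset_pattern.
exact: (measurable_finset_pattern (fun B => B = A)).
Qed.

Section sample.
Variables (R : realType) (mu : probability R R) (n : nat).
Variables (d : measure_display) (T : measurableType d) (P : probability T R).
Variable x : 'I_n -> {RV P >-> R}.
Hypothesis indep : independent_RVs x.
Hypothesis law : forall i, same_distribution (x i) mu.

Definition hits (A : set R) (w : T) : {set 'I_n} :=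
  finset (fun i => x i w \in A).

Lemma in_hits A i : [set w | i \in hits A w] = x i @^-1` A.
Proof. by apply/seteqP; split=> w; rewrite /= inE inE. Qed.

Lemma measurable_hits A Q : measurable A -> measurable [set w | Q (hits A w)].
Proof.
move=> mA; apply: measurable_finset_pattern => i.
by rewrite in_hits; exact: measurable_funPTI.
Qed.

Lemma hits_pattern_prob A (J : {set 'I_n}) : measurable A ->
  P [set w | hits A w = J] =
  (\prod_i (if i \in J then fine (mu A) else 1 - fine (mu A)))%:E.
Proof.
move=> mA; pose B i := if i \in J then A else ~` A.
have mB i : measurable (B i).
  by rewrite /B; case: ifP => _ //; exact: measurableC.
have -> : [set w | hits A w = J] =
    \bigcap_(i in [set` [set: 'I_n]%SET]) (x i @^-1` B i).
  apply/seteqP; split => [w /= wJ i _|w h].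
    by rewrite /B /= -wJ inE; case: ifPn; rewrite ?inE// notin_setE.
  apply/setP => i; have := h i; rewrite /B /= !inE => /(_ isT).
  by case: (i \in J) => /= Ai; [exact/mem_set|exact: memNset].
rewrite indep// big_mkcond -prodEFin; apply: eq_bigr => i _; rewrite inE.
transitivity (mu (B i)); first exact: law.
rewrite /B; case: ifP => _; first by rewrite fineK// fin_num_measure.
by rewrite probability_setC// EFinB fineK// fin_num_measure.
Qed.

(** Summing the exact probabilities of the patterns J with #|J| <= a, each
    weighted by exp (lam (a - #|J|)) >= 1, replaces the exponential moment: the
    weighted sum over all J is the expansion of a product of n equal factors
    p exp (- lam) + 1 - p.  The factor is bounded through
    exp (- lam) <= 1 / (1 + lam) <= 1 - lam + lam ^ 2. *)
Lemma chernoff_lower (A : set R) (lam a : R) : measurable A -> 0 <= lam ->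
  (P [set w | (#|hits A w|%:R <= a)%R] <=
    (expR (lam * a - n%:R * (fine (mu A) * (lam - lam ^+ 2))))%:E)%E.
Proof.
move=> mA lam0; set p := fine (mu A).
have p0 : 0 <= p by exact: fine_ge0.
have p1 : p <= 1 by rewrite -lee_fin fineK ?fin_num_measure// probability_le1.
pose B (J : {set 'I_n}) :=
  [set w | hits A w = J /\ #|J|%:R <= a].
have mB J : measurable (B J).
  exact: (measurable_hits (fun S => S = J /\ #|J|%:R <= a) mA).
have := @union_bound _ _ _ P {set 'I_n} _ B
  (measurable_hits (fun S => #|S|%:R <= a) mA) mB.
move=> /(_ _)/le_trans; apply; first by move=> w h; exists (hits A w).
pose W (J : {set 'I_n}) :=
  \prod_i (if i \in J then p * expR (- lam) else 1 - p).
have PB J : (P (B J) <= (expR (lam * a) * W J)%:E)%E.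
  have [Ja|aJ] := boolP (#|J|%:R <= a); last first.
    rewrite (_ : B J = set0) ?measure0 ?lee_fin.
      rewrite mulr_ge0 ?expR_ge0// prodr_ge0// => i _.
      by case: ifP => _; rewrite ?mulr_ge0 ?expR_ge0 ?subr_ge0.
    by apply/seteqP; split => // w [_]; rewrite (negbTE aJ).
  apply: (@le_trans _ _ (P [set w | hits A w = J])).
    apply: le_measure; rewrite ?inE//; last by move=> w [].
    exact: (measurable_hits (fun S => S = J) mA).
  rewrite hits_pattern_prob// lee_fin.
  have -> : W J = expR (- lam) ^+ #|J| * \prod_i (if i \in J then p else 1 - p).
    rewrite -prodr_const big_mkcond -big_split/=; apply: eq_bigr => i _.
    by case: ifP => _; rewrite ?mul1r// mulrC.
  rewrite mulrA -expRM_natl -expRD ler_peMl//.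
    by rewrite prodr_ge0// => i _; case: ifP => _ //; rewrite subr_ge0.
  by rewrite -[leLHS]expR0 ler_expR mulrN [_%:R * lam]mulrC -mulrBr
    mulr_ge0 ?subr_ge0.
apply: (le_trans (lee_sum _ (fun J _ => PB J))).
rewrite sumEFin lee_fin -big_distrr/= /W.
rewrite -(bigA_distr 1 _ (fun=> p * expR (- lam)) (fun=> 1 - p)).
rewrite [X in _ * X](_ : _ = \prod_(i < n) (p * expR (- lam) + (1 - p)))//.
rewrite prodr_const card_ord expRD ler_wpM2l ?expR_ge0//.
rewrite -mulrN expRM_natl; apply: lerXn2r; rewrite ?nnegrE ?expR_ge0//.
  by rewrite addr_ge0 ?mulr_ge0 ?expR_ge0 ?subr_ge0.
suff h : expR (- lam) <= 1 - lam + lam ^+ 2.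
  apply: (@le_trans _ _ (expR (p * (expR (- lam) - 1)))).
    by apply: le_trans (expR_ge1Dx _); rewrite mulrBr; lra.
  by rewrite ler_expR -mulrN ler_wpM2l//; lra.
have l1 : 1 + lam <= expR lam := expR_ge1Dx lam.
have l0 : 0 < 1 + lam by lra.
rewrite expRN; apply: (@le_trans _ _ (1 + lam)^-1).
  by rewrite lef_pV2 ?posrE ?expR_gt0.
rewrite -div1r ler_pdivrMr//.
have : 0 <= lam ^+ 3 by rewrite exprn_ge0.
by rewrite !exprS expr0; nra.
Qed.

End sample.

(** * Ties have probability zero *)

Lemma measurable_sample_eq d (T : measurableType d) (R : realType)
    (f g : {mfun T >-> R}) : measurable [set w | f w = g w].
Proof.
have -> : [set w | f w = g w] = (fun w => f w == g w) @^-1` [set true].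
  by apply/seteqP; split=> w /eqP.
rewrite -[X in measurable X]setTI.
exact: (@measurable_fun_eqr _ _ _ setT f g).
Qed.

Section ties.
Variables (R : realType) (mu : probability R R) (n : nat).
Variables (d : measure_display) (T : measurableType d) (P : probability T R).
Variable x : 'I_n -> {RV P >-> R}.
Hypothesis ac : mu `<< (@lebesgue_measure R).
Hypothesis indep : independent_RVs x.
Hypothesis law : forall i, same_distribution (x i) mu.

(** Cut [0, 1] into L cells: equal points fall in the same cell of F-values,
    which by independence has probability at most L (1/L)^2 = 1/L. *)
Lemma sample_tie_null i j : i != j -> P [set w | x i w = x j w] = 0%E.
Proof.
move=> ij; have mE := measurable_sample_eq (x i) (x j).
apply/eqP; rewrite eq_le measure_ge0 andbT.
apply/lee_addgt0Pr => e e0; rewrite add0e.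
pose L := (Num.truncn e^-1).+1.
have L0 : 0 < L%:R :> R by rewrite ltr0n.
have Le : L%:R^-1 <= e.
  by rewrite -[e]invrK lef_pV2 ?posrE ?invr_gt0// ltW// truncnS_gt.
pose C (k : 'I_L) := [set z | cdf_of mu z \in `[k%:R / L%:R, k.+1%:R / L%:R]].
have mC k : measurable (C k) by exact: measurable_cdf_band.
have muC k : (mu (C k) <= (L%:R^-1)%:E)%E.
  rewrite (le_trans (cdf_band_le ac _ _ _))//.
  - by rewrite ler_pM2r ?invr_gt0// ler_nat.
  - by rewrite ler_pdivrMr// mul1r ler_nat.
  - by rewrite lee_fin -mulrBl -natrB// subSnn mul1r.
pose B k := \bigcap_(l in [set` [set i; j]%SET]) (x l @^-1` C k).
have mB k : measurable (B k).
  apply: fin_bigcap_measurable => [|l _]; first exact: finite_finset.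
  exact: measurable_funPTI.
have PB k : (P (B k) <= (L%:R^-1 ^+ 2)%:E)%E.
  rewrite indep// big_setU1 ?inE//= big_set1.
  have lawC l : P (x l @^-1` C k) = mu (C k) by exact: law.
  by rewrite !lawC expr2 EFinM lee_pmul.
have := @union_bound _ _ _ P _ _ B mE mB.
move=> /(_ _)/le_trans; apply; last first.
  apply: (le_trans (lee_sum _ (fun k _ => PB k))).
  rewrite sumEFin lee_fin sumr_const card_ord -[leLHS]mulr_natl expr2 mulrA.
  by rewrite divff ?mul1r// lt0r_neq0.
move=> w /= xij; pose u := cdf_of mu (x i w).
have [u0 u1] : 0 <= u /\ u <= 1 by have /andP[] := cdf_of01 mu (x i w).
have [k /andP[ku uk]] : exists k : 'I_L, k%:R / L%:R <= u <= k.+1%:R / L%:R.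
  (* The value u = 1 belongs to no half-open cell; the last one is closed. *)
  move: u1; rewrite le_eqVlt => /predU1P[->|u1].
    exists ord_max; rewrite divff ?lt0r_neq0// lexx andbT.
    by rewrite ler_pdivrMr// mul1r ler_nat.
  have /truncn_itv/andP[tu ut] : 0 <= u * L%:R by rewrite mulr_ge0 ?ler0n.
  have tL : (Num.truncn (u * L%:R) < L)%N.
    by rewrite -(ltr_nat R) (le_lt_trans tu)// gtr_pMl.
  by exists (Ordinal tL); rewrite ler_pdivrMr// ler_pdivlMr// tu ltW.
exists k => l /=; rewrite !inE => /orP[]/eqP->; rewrite /C/= in_itv/=.
  by rewrite -/u ku uk.
by rewrite -xij -/u ku uk.
Qed.

End ties.

(** * Counting the distinct values of a sample *)

Section firsts.
Variables (R : realType) (n : nat).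
Implicit Types (v : 'I_n -> R) (J : {set 'I_n}).

Definition sub_sample v J : {fset R} := [fset v i | i in J]%fset.

(** Each value taken on J is represented by its least index, so that counting
    values becomes counting indices, also when there are ties. *)
Definition firsts v J : {set 'I_n} :=
  finset (fun i => (i \in J) &&
    [forall j, (j \in J) && (j < i)%N ==> (v j != v i)]).

Lemma count_sub_sample v J (p : pred R) :
  count p (sub_sample v J) = #|finset (fun i => (i \in firsts v J) && p (v i))|.
Proof.
have inj : {in firsts v J &, injective v}.
  move=> i j; rewrite !inE => /andP[iJ /forallP hi] /andP[jJ /forallP hj] vij.
  apply/val_inj; case: (ltngtP i j) => // [ij|ji].
    by have := hj i; rewrite iJ ij vij eqxx.
  by have := hi j; rewrite jJ ji vij eqxx.
have /permP -> : perm_eq (sub_sample v J) [seq v i | i <- enum (firsts v J)].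
  apply: uniq_perm; rewrite ?fset_uniq//.
    rewrite map_inj_in_uniq ?enum_uniq// => i j.
    by rewrite !mem_enum; exact: inj.
  move=> y; apply/imfsetP/mapP => /= [[i iJ ->]|[i]]; last first.
    by rewrite mem_enum inE => /andP[iJ _] ->; exists i.
  have [k /andP[kJ /eqP vk] kmin] := @arg_minnP _ i
    (fun j => (j \in J) && (v j == v i)) val (introT andP (conj iJ (eqxx _))).
  exists k => //; rewrite mem_enum inE kJ/=; apply/forallP => j.
  apply/implyP => /andP[jJ jk]; rewrite vk; apply/negP => vj.
  by have := kmin j; rewrite jJ vj leqNgt jk => /(_ isT).
rewrite count_map -size_filter cardE /enum_mem.
rewrite -filter_predI; congr size; apply: eq_filter => i /=.
by rewrite !inE andbC.
Qed.

Lemma card_sub_sample v J : #|` sub_sample v J| = #|firsts v J|.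
Proof.
rewrite -[LHS](count_predT (sub_sample v J)) count_sub_sample.
by apply: eq_card => i; rewrite inE andbT.
Qed.

Lemma firsts_injective v J : injective v -> firsts v J = J.
Proof.
move=> vI; apply/setP => i; rewrite inE; case: (i \in J) => //=.
apply/forallP => j; apply/implyP => /andP[_ ji]; apply/negP => /eqP/vI jE.
by rewrite jE ltnn in ji.
Qed.

Lemma sample_setE v : sample_set v = sub_sample v [set: 'I_n]%SET.
Proof.
apply/fsetP => y; apply/imfsetP/imfsetP => -[i _ ->]; exists i => //=.
by rewrite inE.
Qed.

Lemma sub_sampleP v (Y : {fset R}) :
  (Y `<=` sample_set v)%fset <-> exists J, Y = sub_sample v J.
Proof.
split=> [/fsubsetP YX|[J ->]]; last first.
  by apply/fsubsetP => y /imfsetP[i _ ->]; apply/imfsetP; exists i.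
exists (finset (fun i => v i \in Y)); apply/fsetP => y.
apply/idP/imfsetP => /= [yY|[i]]; last by rewrite inE => ? ->.
by have /imfsetP[i _ yE] := YX y yY; exists i; rewrite ?inE -?yE.
Qed.

End firsts.

(** * Measurability of the event *)

Lemma count_le_near_right (R : realType) (s : seq R) (z : R) :
  \forall t \near z^'+, count (<= t) s = count (<= z) s.
Proof.
elim: s => [|y s IH] /=; first exact: nearW.
have [yz|zy] := lerP y z.
  near=> t; have zt : z < t by near: t; exact: nbhs_right_gt.
  by rewrite (le_trans yz (ltW zt)); congr addn; near: t.
near=> t; have ty : t < y by near: t; exact: nbhs_right_lt.
by rewrite leNgt ty/= add0n; near: t.
Unshelve. all: by end_near. Qed.

(** Right of z and close to it, the empirical distribution function is constant
    and F is close to F(z); so an excess at z shows at a rational point. *)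
Lemma discrepancy_leP (R : realType) (Y : {fset R}) (F : R -> R) (c : R) :
  (forall z, F t @[t --> z^'+] --> F z) ->
  (discrepancy Y F <= c%:E)%E <->
  forall r : rat, `|empirical_cdf Y (ratr r) - F (ratr r)| <= c.
Proof.
move=> rcF; split=> [Yc r|Yc].
  rewrite -lee_fin; apply: le_trans Yc; apply: ereal_sup_ubound.
  by exists (ratr r).
apply: ge_ereal_sup => _ [z _ <-]; rewrite lee_fin leNgt; apply/negP => cz.
have cvgz : `|empirical_cdf Y z - F t| @[t --> z^'+] -->
    `|empirical_cdf Y z - F z|.
  by apply: cvg_norm; apply: cvgB; [exact: cvg_cst|exact: rcF].
have near1 : \forall t \near z^'+, c < `|empirical_cdf Y z - F t|.
  exact: (cvgr_gt _ cvgz).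
have [e /= e0 he] := filterI near1 (count_le_near_right Y z).
have /rat_in_itvoo[r] : z < z + e by rewrite ltrDl.
rewrite in_itv/= => /andP[zr re].
have /= [|cr E] := he (ratr r) _ zr.
  by rewrite distrC ger0_norm ?subr_ge0 ?ltW// ltrBlDl.
have := Yc r; rewrite leNgt => /negP; apply.
by rewrite /empirical_cdf card_fset_filter E -card_fset_filter.
Qed.

Section measurability.
Variables (R : realType) (mu : probability R R) (n : nat).
Variables (d : measure_display) (T : measurableType d).
Variable x : 'I_n -> {mfun T >-> R}.
Let sample w := fun i => x i w.

Lemma measurable_firsts J i : measurable [set w | i \in firsts (sample w) J].
Proof.
have [iJ|iJ] := boolP (i \in J); last first.
  rewrite (_ : [set _ | _] = set0)//; apply/seteqP; split=> // w.
  by rewrite /= inE (negbTE iJ).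
have -> : [set w | i \in firsts (sample w) J] =
    \bigcap_(j in [set j | (j \in J) && (j < i)%N]) ~` [set w | x j w = x i w].
  apply/seteqP; split=> w /=.
    by rewrite inE iJ/= => /forallP h j /= ji; apply/eqP; exact: (implyP (h j)).
  move=> h; rewrite inE iJ/=; apply/forallP => j; apply/implyP => ji.
  by apply/eqP; exact: (h j ji).
apply: fin_bigcap_measurable => [|j _]; first exact: finite_finset.
by apply: measurableC; exact: measurable_sample_eq.
Qed.

(** For a fixed set of indices J and a fixed rational, the condition depends
    only on [firsts] and on which of its indices have a value up to the
    rational. *)
Lemma measurable_exists_subsample (Q : nat -> nat -> Prop) (c : R) :
  measurable [set w | exists Y : {fset R},
    [/\ (Y `<=` sample_set (sample w))%fset,
        Q #|` sample_set (sample w)| #|` Y| &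
        (discrepancy Y (cdf_of mu) <= c%:E)%E]].
Proof.
pose E (J : {set 'I_n}) :=
  [set w | Q #|firsts (sample w) [set: 'I_n]%SET| #|firsts (sample w) J|] `&`
  \bigcap_(r : rat) [set w | `|empirical_cdf (sub_sample (sample w) J) (ratr r)
                    - cdf_of mu (ratr r)| <= c].
have EP J w : E J w <->
    Q #|` sample_set (sample w)| #|` sub_sample (sample w) J|
    /\ (discrepancy (sub_sample (sample w) J) (cdf_of mu) <= c%:E)%E.
  rewrite sample_setE !card_sub_sample discrepancy_leP; last first.
    exact: cdf_of_right_continuous.
  by split=> -[QJ h]; split=> // r; [exact: h|move=> _; exact: h].
rewrite (_ : [set _ | _] = \bigcup_(J in [set: {set 'I_n}]) E J); last first.
  apply/seteqP; split=> w /=.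
    by move=> [Y [/sub_sampleP[J ->] QY Yc]]; exists J => //; apply/EP.
  move=> [J _ /EP[QY Yc]]; exists (sub_sample (sample w) J); split=> //.
  by apply/sub_sampleP; exists J.
apply: fin_bigcup_measurable => [|J _]; first exact: finite_finset.
apply: measurableI.
  apply: (measurable_finset_pattern2 (fun A B => Q #|A| #|B|)) => i;
    exact: measurable_firsts.
rewrite -[X in measurable X]setCK setC_bigcap; apply: measurableC.
apply: bigcupT_measurable_rat => r; apply: measurableC.
pose A w : {set 'I_n} := finset (fun i =>
  (i \in firsts (sample w) J) && (x i w <= ratr r)).
rewrite (_ : [set _ | _] = [set w | `|#|A w|%:R / #|firsts (sample w) J|%:R
    - cdf_of mu (ratr r)| <= c]); last first.
  apply/seteqP; split=> w; rewrite /= /empirical_cdf card_fset_filter;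
  by rewrite count_sub_sample card_sub_sample.
apply: (measurable_finset_pattern2
  (fun A B => `|#|A|%:R / #|B|%:R - cdf_of mu (ratr r)| <= c)) => i; last first.
  exact: measurable_firsts.
rewrite (_ : [set _ | _] = [set w | i \in firsts (sample w) J] `&`
    (x i @^-1` `]-oo, ratr r])); last first.
  have AE w : (i \in A w) = (i \in firsts (sample w) J) && (x i w <= ratr r).
    by rewrite /A finset.in_set.
  apply/seteqP; split=> w; rewrite /= in_itv/= AE; first by move/andP.
  by move=> [-> ->].
apply: measurableI; first exact: measurable_firsts.
exact: measurable_funPTI.
Qed.

End measurability.

(** * The bound on the probability *)

Lemma half_le_ln (R : realType) (n : nat) :
  (2 <= n)%N -> 1 / 2 <= ln (n%:R : R).
Proof.
move=> n2; have n0 : 0 < n%:R :> R by rewrite ltr0n (leq_trans _ n2).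
have ni : n%:R^-1 <= 2^-1 :> R by rewrite lef_pV2 ?posrE ?ler_nat.
have := @le_ln1Dx R (n%:R^-1 - 1).
rewrite [1 + _]addrC subrK lnV ?posrE//.
have : 0 < n%:R^-1 :> R by rewrite invr_gt0.
by move=> p /(_ _); lra.
Qed.

(** Rounding ]s, t[ inwards to the grid Z / n loses less than 2 / n of its
    length, hence at most two points of its share; with the two points lost in
    [thinning_discrepancy] the error is D + 4, and 4 is absorbed since
    log n >= 1 / 2 and m <= n / 1000. *)
Lemma dense_grid_thinning (R : realType) (F : R -> R) (n : nat) (m : R)
    (v : 'I_n -> R) (D := 4 * n%:R * ln n%:R / m) :
  {homo F : x y / x <= y} -> (forall x, 0 <= F x <= 1) ->
  (2 <= n)%N -> 0 < m <= 1 / 1000 * n%:R -> injective v ->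
  (forall i j : 'I_n.+1, (i < j)%N ->
    (n%:R - m) * (j%:R / n%:R - i%:R / n%:R) - D <
    #|finset (fun k => i%:R / n%:R < F (v k) < j%:R / n%:R)|%:R) ->
  exists Y : {fset R}, [/\ (Y `<=` sample_set v)%fset,
    #|` sample_set v|%:R - m <= #|` Y|%:R &
    (discrepancy Y F <= (100 * ln n%:R / m)%:E)%E].
Proof.
move=> Fmono F01 n2 /andP[m0 mn] vI grid.
have n0 : 0 < n%:R :> R by rewrite ltr0n (leq_trans _ n2).
have l0 := half_le_ln R n2.
have X_n : #|` sample_set v| = n.
  by rewrite sample_setE card_sub_sample firsts_injective// cardsT card_ord.
have D0 : 0 <= D.
  by rewrite /D divr_ge0 ?mulr_ge0 ?(ltW m0) ?(ltW n0)//; lra.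
have dense s t : 0 <= s -> s <= t -> t <= 1 ->
    (n%:R - m) * (t - s) - (D + 2) <=
    (count (fun x => s < F x < t) (sample_set v))%:R.
  move=> s0 st t1.
  pose i := (Num.truncn (n%:R * s)).+1; pose j := Num.truncn (n%:R * t).
  have := @truncn_itv _ (n%:R * s) (mulr_ge0 (ltW n0) s0).
  have := @truncn_itv _ (n%:R * t) (mulr_ge0 (ltW n0) (le_trans s0 st)).
  rewrite -/i -/j => /andP[jt tj] /andP[si is_].
  have [ij|ji] := ltnP i j; last first.
    (* ]s, t[ is shorter than 2 / n, so its share is at most 2. *)
    apply: le_trans (ler0n _ _); have : j%:R <= i%:R :> R by rewrite ler_nat.
    move: tj si is_; rewrite /i -!natr1.
    set i' := (Num.truncn _)%:R => tj si is_ ji'.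
    have : n%:R * (t - s) <= 2 by rewrite mulrBr; lra.
    nra.
  have jn : (j < n.+1)%N.
    by rewrite ltnS -(ler_nat R) (le_trans jt)// ger_pMr.
  have in_ : (i < n.+1)%N by exact: ltn_trans jn.
  have := grid (Ordinal in_) (Ordinal jn) ij.
  rewrite /= => /ltW h.
  apply: (@le_trans _ _
      #|finset (fun k => i%:R / n%:R < F (v k) < j%:R / n%:R)|%:R); last first.
    rewrite ler_nat sample_setE count_sub_sample firsts_injective//.
    apply: subset_leq_card; apply/fintype.subsetP => k.
    rewrite !inE/= => /andP[ik kj].
    apply/andP; split.
      by apply: lt_trans ik; rewrite ltr_pdivlMr// mulrC.
    by apply: (lt_le_trans kj); rewrite ler_pdivrMr// mulrC.
  apply: le_trans h.
  have : t - s <= j%:R / n%:R - i%:R / n%:R + 2 / n%:R.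
    rewrite -mulrBl -mulrDl ler_pdivlMr// mulrC mulrBr.
    by move: si; rewrite /i -natr1; lra.
  set u := _ - _ / _ => tsu.
  have : (n%:R - m) * (2 / n%:R) <= 2.
    by rewrite mulrA ler_pdivrMr//; lra.
  nra.
have [|||Y [YX mY Yd]] :=
  @thinning_discrepancy R F m (D + 2) (sample_set v) Fmono F01; rewrite ?X_n//.
- by apply/andP; split; lra.
- by lra.
exists Y; split=> //; first by rewrite X_n in mY.
apply: ge_ereal_sup => _ [z _ <-]; rewrite lee_fin.
apply: (le_trans (Yd z)); rewrite X_n ler_pdivrMr; last by lra.
rewrite /D -!(mulrA _ _ m^-1); set y := ln n%:R / m.
have ym : ln n%:R = y * m by rewrite /y mulfVK// lt0r_neq0.
have y0 : 0 <= y by rewrite /y divr_ge0 ?(ltW m0)//; lra.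
have : y * m <= y * (1 / 1000 * n%:R) by rewrite ler_wpM2l.
rewrite ym in l0; lra.
Qed.

Section sparse_bands.
Variables (R : realType) (mu : probability R R) (n : nat) (m : R).
Variables (d : measure_display) (T : measurableType d) (P : probability T R).
Variable x : 'I_n -> {RV P >-> R}.
Hypothesis ac : mu `<< (@lebesgue_measure R).
Hypothesis indep : independent_RVs x.
Hypothesis law : forall i, same_distribution (x i) mu.
Hypothesis n2 : (2 <= n)%N.
Hypothesis mn : 0 < m <= 1 / 1000 * n%:R.

Let band (i j : 'I_n.+1) : set R :=
  [set z | cdf_of mu z \in `]i%:R / n%:R, j%:R / n%:R[].

Let quota (i j : 'I_n.+1) : R :=
  (n%:R - m) * (j%:R / n%:R - i%:R / n%:R) - 4 * n%:R * ln n%:R / m.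

(** In Chernoff's bound at lam = m / n, the part of the exponent that grows with
    the mass p of the band cancels against lam times its share (n - m) p;
    what remains is - (m / n) D = - 4 ln n. *)
Lemma sparse_band_prob (i j : 'I_n.+1) :
  (P [set w | (#|hits x (band i j) w|%:R <= quota i j)%R]
    <= (n%:R ^- 4)%:E)%E.
Proof.
have n0 : 0 < n%:R :> R by rewrite ltr0n (leq_trans _ n2).
have mB : measurable (band i j) by exact: measurable_cdf_band.
have /andP[m0 mn'] := mn.
have lam0 : 0 <= m / n%:R by rewrite divr_ge0 ?ltW.
apply: (le_trans (chernoff_lower indep law _ mB lam0)); rewrite lee_fin.
have -> : n%:R ^- 4 = expR (- (4 * ln n%:R)) :> R.
  by rewrite expRN expRM_natl lnK ?posrE.
rewrite ler_expR.
have : j%:R / n%:R - i%:R / n%:R <= fine (mu (band i j)).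
  rewrite -lee_fin fineK ?fin_num_measure//; apply: cdf_band_ge => //.
  by rewrite ler_pdivrMr// mul1r ler_nat -ltnS.
rewrite /quota; set u := _ - _ => up; set p := fine _ in up *.
have -> : m / n%:R * ((n%:R - m) * u - 4 * n%:R * ln n%:R / m) -
    n%:R * (p * (m / n%:R - (m / n%:R) ^+ 2)) =
    - (4 * ln n%:R) - m / n%:R * (n%:R - m) * (p - u).
  by field; rewrite !lt0r_neq0.
rewrite gerBl mulr_ge0 ?subr_ge0// mulr_ge0// subr_ge0; lra.
Qed.

(** The bad events are indexed by a sum type: the sparse grid bands, of total
    probability at most (n + 1)^2 / n^4 <= 4 / n, and the ties, which are
    null. *)
Lemma good_sample_prob (E : set T) : measurable E ->
  (forall w, injective (fun i => x i w) ->
    (forall i j : 'I_n.+1, (i < j)%N ->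
      quota i j < #|hits x (band i j) w|%:R) -> E w) ->
  ((1 - 4 * n%:R^-1)%:E <= P E)%E.
Proof.
move=> mE good.
have n0 : 0 < n%:R :> R by rewrite ltr0n (leq_trans _ n2).
pose I := (('I_n.+1 * 'I_n.+1) + ('I_n * 'I_n))%type.
pose B (k : I) : set T := match k with
  | inl ij => [set w | #|hits x (band ij.1 ij.2) w|%:R <= quota ij.1 ij.2]
  | inr ij => if ij.1 != ij.2 then [set w | x ij.1 w = x ij.2 w] else set0
  end.
have mB k : measurable (B k).
  case: k => -[i j] /=; last by case: ifP => // _; exact: measurable_sample_eq.
  exact: (@measurable_hits _ _ _ _ P x _ (fun A => #|A|%:R <= quota i j)
    (measurable_cdf_band _ _)).
have := @union_bound _ _ _ P I (~` E) B (measurableC mE) mB.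
move=> /(_ _)/le_trans h.
have : (P (~` E) <= (4 * n%:R^-1)%:E)%E.
  apply: h.
    move=> w nE; apply: contrapT => nB; apply: nE; apply: good.
      move=> i j xij; apply: contrapT => /eqP ij; apply: nB.
      by exists (inr (i, j)); rewrite /B/= ij.
    move=> i j ij; rewrite ltNge; apply/negP => bad; apply: nB.
    by exists (inl (i, j)).
  rewrite big_sumType/= [X in (_ + X <= _)%E]big1 ?adde0; last first.
    move=> [i j] _ /=; case: ifPn => [ij|_]; last exact: measure0.
    exact: (sample_tie_null ac indep law).
  apply: (le_trans (lee_sum _ (fun ij _ => sparse_band_prob ij.1 ij.2))).
  rewrite sumEFin lee_fin sumr_const card_prod card_ord.
  have n1 : 1 <= n%:R :> R by rewrite ler1n (leq_trans _ n2).
  rewrite -[leLHS]mulr_natr natrM mulrC -ler_pdivlMr ?invr_gt0 ?exprn_gt0//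
    invrK.
  have -> : 4 * n%:R^-1 * n%:R ^+ 4 = 4 * n%:R ^+ 3 :> R.
    by rewrite exprS mulrA mulfVK// lt0r_neq0.
  by rewrite -natr1 !exprS expr0; nra.
rewrite probability_setC// => h'.
rewrite -[P E]fineK ?fin_num_measure// lee_fin.
move: h'; rewrite -[P E]fineK ?fin_num_measure// -EFinB lee_fin; lra.
Qed.

End sparse_bands.

Theorem mainTheorem2 (R : realType) :
  exists C K : R, [/\ 0 < C, 0 < K &
    forall (mu : probability R R) (n : nat) (m : R)
      (d : measure_display) (T : measurableType d) (P : probability T R)
      (x : 'I_n -> {RV P >-> R}),
    mu `<< (@lebesgue_measure R) ->
    (1 <= n)%N ->
    0 <= m <= 1 / 1000 * n%:R ->
    independent_RVs x ->
    (forall i : 'I_n, same_distribution (x i) mu) ->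
    let E : set T := [set w |
      let X := sample_set (fun i => x i w) in
      exists Y : {fset R}, [/\ (Y `<=` X)%fset,
        #|` X|%:R - m <= #|` Y|%:R :> R &
        (discrepancy Y (cdf_of mu) <=
          div_or_pinfty (100 * ln (n%:R : R)) m)%E]] in
    measurable E /\ ((1 - K * n%:R `^ (- C))%:E <= P E)%E].
Proof.
exists 1, 4; split => // mu n m d T P x ac n1 /andP[m0 mn] indep law E.
have n0 : 0 < n%:R :> R by rewrite ltr0n.
rewrite powR_inv1 ?(ltW n0)//.
have [mz|mNz] := eqVneq m 0.
  (* The right-hand side is infinite and Y = X qualifies. *)
  have -> : E = setT.
    apply/seteqP; split=> // w _; exists (sample_set (fun i => x i w)).
    by rewrite mz subr0 /div_or_pinfty eqxx; split=> //; exact: leey.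
  split=> //; rewrite probability_setT lee_fin gerBl.
  by rewrite mulr_ge0 ?invr_ge0 ?(ltW n0).
have mE : measurable E.
  rewrite /E /div_or_pinfty (negbTE mNz).
  exact: (measurable_exists_subsample _ _ (fun a b => a%:R - m <= b%:R :> R)).
split=> //.
have [n2|] := leqP 2 n; last first.
  (* For n = 1 the claimed lower bound 1 - 4 is negative. *)
  rewrite ltnS => n1'; have -> : n = 1%N by apply/eqP; rewrite eqn_leq n1' n1.
  by apply: le_trans (measure_ge0 _ _); rewrite lee_fin invr1; lra.
have mpos : 0 < m <= 1 / 1000 * n%:R by rewrite lt_neqAle eq_sym mNz m0 mn.
apply: (good_sample_prob ac indep law n2 mpos mE) => w xI grid.
rewrite /E/= /div_or_pinfty (negbTE mNz).
apply: (dense_grid_thinning _ _ n2 mpos xI).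
- exact: cdf_of_le.
- exact: cdf_of01.
move=> i j ij; have := grid i j ij; congr (_ < _%:R).
apply: eq_card => k; rewrite !inE /=.
by apply/idP/idP => [/set_mem|h]; [|apply/mem_set]; rewrite /= in_itv.
Qed.
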